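(* Let $t\ge 1$ and $n_1,\dots,n_t\ge 1$ be integers, $n=n_1+\cdots+n_t$, and let $M$ be a real $n\times n$ matrix written in block form $M=(M_{ij})_{1\le i,j\le t}$, where $M_{ij}$ is an $n_i\times n_j$ block. Suppose that $M_{ii}=l_iJ_{n_i}+p_iI_{n_i}$ for every $i\in\{1,\dots,t\}$, and $M_{ij}=s_{ij}J_{n_i,n_j}$ for all $i\neq j$ in $\{1,\dots,t\}$, where $l_i,p_i,s_{ij}$ are real numbers. Let $B=B(M)$ be the quotient matrix of $M$. Then $$\sigma(M)=\sigma(B)\cup\{p_i^{[n_i-1]}\mid i=1,2,\dots,t\},$$ where the union is a union of multisets (eigenvalues counted with multiplicity).
   Context: $I_p$ is the $p\times p$ identity matrix, $J_{p,q}$ is the $p\times q$ all-ones matrix, and $J_p=J_{p,p}$. $\sigma(M)$ denotes the spectrum of a square matrix $M$, i.e. the multiset of its (complex) eigenvalues. $\lambda^{[m]}$ means that $\lambda$ is listed with multiplicity $m$. The quotient matrix of a block matrix $M=(M_{ij})_{1\le i,j\le t}$ (with $M_{ij}$ of size $n_i\times n_j$) is the $t\times t$ matrix $B(M)=(b_{ij})$, where $b_{ij}$ is the average row sum of $M_{ij}$, i.e. the sum of all entries of $M_{ij}$ divided by the number of its rows $n_i$. *)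

(* Defs.v *)
From HB Require Import structures.
From mathcomp Require Import all_boot all_order all_algebra.
From mathcomp Require Import finmap multiset complex reals.

Set Implicit Arguments.
Unset Strict Implicit.
Unset Printing Implicit Defensive.

Import Order.TTheory GRing.Theory Num.Theory.

Local Open Scope ring_scope.
Local Open Scope mset_scope.

(* Eigenvalues counted with algebraic multiplicity: the roots of the
   characteristic polynomial; see [spectrumE] and [in_spectrum]. *)
Definition spectrum (C : closedFieldType) n (A : 'M[C]_n) : {mset C} :=
  seq_mset (sval (closed_field_poly_normal (char_poly A))).

Definition complex_spectrum (R : realType) n (A : 'M[R]_n) : {mset R[i]} :=
  spectrum (map_mx (real_complex R) A).

(* (i, j) entry: the average row sum of the block (i, j), that is, the sum of
   its entries divided by its number of rows. *)
Definition quotient_mx (R : realType) t (n_ : 'I_t -> nat)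
    (M : 'M[R]_(\sum_i n_ i)) : 'M[R]_t :=
  \matrix_(i, j)
    ((\sum_a \sum_b submxblock M i j a b) / (n_ i)%:R).

Lemma spectrumE (C : closedFieldType) n (A : 'M[C]_n) x :
  spectrum A x = mup x (char_poly A).
Proof.
rewrite /spectrum; case: closed_field_poly_normal => s /= eqA.
have -> : seq_mset s x = count_mem x s.
  by rewrite fsfunE !inE; case: ifP => // /negbT/count_memPn ->.
rewrite {}eqA (monicP (char_poly_monic A)) scale1r.
elim: s => [|y s IHs]; first by rewrite big_nil mupNroot ?root1.
rewrite big_cons mupM ?polyXsubC_eq0 //=; last first.
  by rewrite monic_neq0 ?monic_prod_XsubC.
by rewrite IHs -['X - y%:P]expr1 mup_XsubCX; congr (_ + _)%N; case: (y == x).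
Qed.

Lemma in_spectrum (C : closedFieldType) n (A : 'M[C]_n) x :
  (x \in spectrum A) = eigenvalue A x.
Proof.
by rewrite in_mset spectrumE eigenvalue_root_char -XsubC_dvd ?dvdp_XsubCl
           ?monic_neq0 ?char_poly_monic.
Qed.

(* Main.v *)
Require Import Defs.
From mathcomp Require Import all_boot all_order all_algebra.
From mathcomp Require Import finmap multiset complex reals.
From mathcomp Require Import ring.

Set Implicit Arguments.
Unset Strict Implicit.
Unset Printing Implicit Defensive.

Import Order.TTheory GRing.Theory Num.Theory.

Local Open Scope ring_scope.
Local Open Scope mset_scope.

(** Write [M] as [D + P K P^T], where [P] is the incidence matrix of the blocks, [D] is diagonal
    with value [p i] on block [i], and [K] holds the [l i] and [s i j]. Since [P^T P] is diagonal
    with entries [n_ i], the quotient matrix is [diag p + K P^T P]. The identity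
    [det_sub_mul_intertwine], applied to the characteristic matrices, gives in [char_poly_fiberwise]
    that [char_poly M] times the product of the [X - p i] equals [char_poly (quotient_mx M)] times
    the product of the [(X - p i)^(n_ i)]. Cancelling yields [char_poly_quotient]; root
    multiplicities over the complex numbers then give the spectra. *)

(* The Weinstein-Aronszajn identity without inverses: compute the determinant
   of [[A, P], [Q, 1]] by two column reductions, where AP = PB clears the upper
   right block in the second one. *)
Lemma det_sub_mul_intertwine (R : comNzRingType) m n (A : 'M[R]_m) (B : 'M[R]_n)
    (P : 'M[R]_(m, n)) (Q : 'M[R]_(n, m)) :
  A *m P = P *m B ->
  \det (A - P *m Q) * \det B = \det A * \det (B - Q *m P).
Proof.
move=> AP; pose W := block_mx A P Q 1%:M.
have WL : W *m block_mx 1%:M 0 (- Q) 1%:M = block_mx (A - P *m Q) P 0 1%:M.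
  rewrite mulmx_block !mulmx1 !mulmx0 !add0r !mulmxN !mul1mx.
  by rewrite subrr.
have WR : W *m block_mx 1%:M (- P) 0 B = block_mx A 0 Q (B - Q *m P).
  rewrite mulmx_block !mulmx1 !mulmx0 !addr0 !mulmxN mul1mx AP addNr.
  by rewrite [- _ + _]addrC.
have := congr1 determinant WL.
rewrite det_mulmx det_lblock det_ublock !det1 !mulr1 => <-.
have := congr1 determinant WR.
by rewrite det_mulmx det_ublock det_lblock det1 mul1r.
Qed.

(* The matrix is D + P K P^T, with P the incidence matrix of the partition of
   the indices into the fibers of [f] and D diagonal, constant on fibers. *)
Lemma char_poly_fiberwise (R : comNzRingType) n t (f : 'I_n -> 'I_t)
    (p : 'I_t -> R) (K : 'I_t -> 'I_t -> R) :
  char_poly (\matrix_(a, b) (K (f a) (f b) + p (f a) *+ (a == b)))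
    * \prod_i ('X - (p i)%:P) =
  \prod_a ('X - (p (f a))%:P) *
    char_poly (\matrix_(i, j)
      (K i j *+ #|[pred a | f a == j]| + p i *+ (i == j))).
Proof.
pose A : 'M[{poly R}]_n := diag_mx (\row_a ('X - (p (f a))%:P)).
pose B : 'M[{poly R}]_t := diag_mx (\row_i ('X - (p i)%:P)).
pose P : 'M[{poly R}]_(n, t) := \matrix_(a, i) (f a == i)%:R.
pose Q : 'M[{poly R}]_(t, n) := \matrix_(i, a) (K i (f a))%:P.
have sumP k (G : 'I_t -> {poly R}) : \sum_i (k == i)%:R * G i = G k.
  rewrite (bigD1 k) //= eqxx mul1r big1 ?addr0 // => i /negPf ik.
  by rewrite eq_sym ik mul0r.
(* Entry [(a, i)] vanishes on both sides unless [f a = i], and then both diagonal factors are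
   ['X - (p i)%:P]. *)
have AP : A *m P = P *m B.
  rewrite mul_diag_mx mul_mx_diag; apply/matrixP=> a i; rewrite !mxE.
  by case: eqP => [->|_]; rewrite ?mulr1 ?mul1r ?mulr0 ?mul0r.
have detA : \det A = \prod_a ('X - (p (f a))%:P).
  by rewrite det_diag; apply: eq_bigr => a _; rewrite mxE.
have detB : \det B = \prod_i ('X - (p i)%:P).
  by rewrite det_diag; apply: eq_bigr => i _; rewrite mxE.
rewrite -detA -detB /char_poly.
rewrite [char_poly_mx _](_ : _ = A - P *m Q); last first.
  apply/matrixP=> a b; rewrite !mxE.
  under eq_bigr => i _ do rewrite !mxE.
  rewrite sumP; case: eqP => [->|_]; rewrite ?mulr1n ?mulr0n ?addr0 ?polyCD; ring.
rewrite [char_poly_mx (\matrix_(i, j) _)](_ : _ = B - Q *m P).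
  exact: det_sub_mul_intertwine.
apply/matrixP=> i j; rewrite !mxE.
(* Here [Q] is [K P^T], and [P^T P] is diagonal with the fiber sizes as entries. *)
have -> : \sum_a Q i a * P a j = (K i j)%:P *+ #|[pred a | f a == j]|.
  rewrite -sumr_const [RHS]big_mkcond /=; apply: eq_bigr => a _.
  by rewrite !mxE inE; case: eqP => [->|_]; rewrite ?mulr1 ?mulr0.
by rewrite polyCD !polyCMn; case: eqP => [->|_]; rewrite ?mulr1n ?mulr0n ?addr0; ring.
Qed.

Lemma big_sig1 (T : Type) (idx : T) (op : Monoid.com_law idx) t
    (n_ : 'I_t -> nat) (F : 'I_t -> T) :
  \big[op/idx]_(a < \sum_i n_ i) F (tagnat.sig1 a) =
  \big[op/idx]_(i < t) \big[op/idx]_(x < n_ i) F i.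
Proof. by rewrite sig_big_dep /= (reindex _ tagnat.sig_bij_on). Qed.

Lemma card_sig1 t (n_ : 'I_t -> nat) (j : 'I_t) :
  #|[pred a : 'I_(\sum_i n_ i) | tagnat.sig1 a == j]| = n_ j.
Proof.
rewrite -sum1_card big_mkcond (big_sig1 _ _ (fun i => if i == j then 1 else 0)%N).
rewrite (bigD1 j) //= eqxx sum_nat_const card_ord muln1 big1 ?addn0 // => i.
by move=> /negPf ij; rewrite ij big1.
Qed.

(** Instance of [char_poly_fiberwise] where [f] sends a flat index to its block, so that the fibers
    have sizes [n_ i]. *)
Lemma char_poly_quotient (R : realType) t (n_ : 'I_t -> nat)
    (n_gt0 : forall i, (0 < n_ i)%N) (M : 'M[R]_(\sum_i n_ i))
    (l p : 'I_t -> R) (s : 'I_t -> 'I_t -> R) :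
  (forall i, submxblock M i i = l i *: const_mx 1 + p i *: 1%:M) ->
  (forall i j, i != j -> submxblock M i j = s i j *: const_mx 1) ->
  char_poly M =
    char_poly (quotient_mx M) * \prod_i ('X - (p i)%:P) ^+ (n_ i - 1).
Proof.
move=> Mdiag Moff; pose K i j := if i == j then l i else s i j.
(* Comparing flat indices through [tagnat.Rank] lets one formula cover diagonal and off-diagonal
   blocks. *)
have blockE i j x y : submxblock M i j x y =
    K i j + p i *+ (tagnat.Rank i x == tagnat.Rank j y).
  rewrite -val_eqE /= tagnat.eq_Rank /K; case: (eqVneq i j) => [ij|ij].
    by case: _ / ij y => y; rewrite Mdiag !mxE mulr1 mulr_natr.
  by rewrite Moff // !mxE mulr1 addr0.
have ME : M = \matrix_(a, b) (K (tagnat.sig1 a) (tagnat.sig1 b)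
                              + p (tagnat.sig1 a) *+ (a == b)).
  apply/matrixP=> a b; rewrite mxE -{1}(tagnat.sig2K a) -{1}(tagnat.sig2K b).
  have := blockE _ _ (tagnat.sig2 a) (tagnat.sig2 b).
  by rewrite mxE !tagnat.sig2K.
have QE : quotient_mx M = \matrix_(i, j)
    (K i j *+ #|[pred a : 'I_(\sum_i n_ i) | tagnat.sig1 a == j]|
     + p i *+ (i == j)).
  apply/matrixP=> i j; rewrite !mxE card_sig1.
  have nz : (n_ i)%:R != 0 :> R by rewrite pnatr_eq0 -lt0n.
  apply: canLR (mulfK nz) _.
  (* All rows of a block have the same sum, so the average row sum is that common value. *)
  transitivity (\sum_(x < n_ i) (K i j *+ n_ j + p i *+ (i == j))); last first.
    by rewrite sumr_const card_ord mulr_natr.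
  apply: eq_bigr => x _; under eq_bigr => y _ do rewrite blockE.
  rewrite big_split /= sumr_const card_ord; congr (_ + _).
  under eq_bigr => y _ do rewrite -val_eqE /= tagnat.eq_Rank.
  case: (eqVneq i j) => [ij|_]; last by rewrite big1.
  case: _ / ij; rewrite (bigD1 x) //= eqxx big1 ?addr0 // => y.
  by rewrite -val_eqE eq_sym => /negPf /= ->.
(* Polynomials over a field form a domain, so the extra factor can be cancelled. *)
have linN0 i : 'X - (p i)%:P != 0 by rewrite polyXsubC_eq0.
have prodN0 : \prod_i ('X - (p i)%:P) != 0 by apply/prodf_neq0.
apply: (mulIf prodN0); rewrite {1}ME char_poly_fiberwise -QE.
rewrite mulrC -mulrA -big_split /=; congr (_ * _).
rewrite (big_sig1 _ _ (fun i => 'X - (p i)%:P)); apply: eq_bigr => i _.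
(* Positivity of [n_ i] makes the truncated [n_ i - 1] a true predecessor. *)
by rewrite prodr_const card_ord -exprSr subn1 prednK.
Qed.

Lemma mup_prod (F : fieldType) (I : Type) (r : seq I) (x : F)
    (q : I -> {poly F}) :
  (forall i, q i != 0) ->
  mup x (\prod_(i <- r) q i) = (\sum_(i <- r) mup x (q i))%N.
Proof.
move=> qN0; elim: r => [|i r IHr]; first by rewrite !big_nil mupNroot ?root1.
by rewrite !big_cons mupM ?IHr // prodf_seq_neq0; apply: allT.
Qed.

Lemma big_msetDE (K : choiceType) (I : Type) (r : seq I) (A : I -> {mset K}) x :
  (\big[msetD/mset0]_(i <- r) A i) x = (\sum_(i <- r) A i x)%N.
Proof. by elim/big_rec2: _ => [|i m B _ <-]; rewrite ?mset0E ?msetE2. Qed.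

Theorem lemma3p3 (R : realType) (t : nat) (n_ : 'I_t -> nat)
  (t_ge1 : (1 <= t)%N) (n_ge1 : forall i : 'I_t, (1 <= n_ i)%N)
  (M : 'M[R]_(\sum_i n_ i))
  (l p : 'I_t -> R) (s : 'I_t -> 'I_t -> R)
  (M_diag : forall i : 'I_t,
     submxblock M i i = l i *: const_mx 1 + p i *: 1%:M)
  (M_offdiag : forall i j : 'I_t, i != j ->
     submxblock M i j = s i j *: const_mx 1) :
  complex_spectrum M =
    complex_spectrum (quotient_mx M) `+`
    \big[msetD/mset0]_(i < t) msetn (n_ i - 1)%N (real_complex R (p i)).
Proof.
(* Compare the multiplicities of each complex [x]; [mup] turns products of nonzero polynomials into
   sums. *)
apply/msetP=> x; rewrite msetE2 big_msetDE /complex_spectrum !spectrumE.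
rewrite -!map_char_poly (char_poly_quotient n_ge1 M_diag M_offdiag).
have linN0 i : ('X - (real_complex R (p i))%:P) ^+ (n_ i - 1) != 0.
  by rewrite expf_neq0 ?polyXsubC_eq0.
rewrite rmorphM rmorph_prod /=.
under eq_bigr => i _ do rewrite rmorphXn /= rmorphB /= map_polyX map_polyC.
rewrite mupM ?mup_prod //; first last.
- by rewrite prodf_seq_neq0; apply: allT => i; exact: linN0.
- by rewrite map_char_poly monic_neq0 ?char_poly_monic.
congr (_ + _)%N; apply: eq_bigr => i _.
by rewrite mup_XsubCX msetnE eq_sym.
Qed.
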